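(* Let Problem 1 (the multi-commodity dynamic traffic assignment problem) and Problem 2 (its relaxation) be as defined in the context, with a cost function $\varphi(x,z)$ that is convex and differentiable in $(x,z)$, with $\frac{\partial}{\partial x}\varphi(x,z)\ge 0$, $\frac{\partial}{\partial z}\varphi(x,z)\le 0$ (entrywise) and $\varphi(0,0)=0$. Then Problem 2 is convex, and every feasible solution of Problem 1 is also feasible for Problem 2 (that is, if $x,f,z$ are the volumes, cell-to-cell flows and outflows generated by controls $(\alpha,R)$ in Problem 1, then $\bar x=x$, $\bar f=f$, $\mu_i^{(k)}=z_i^{(k)}$ for $i\in\mathcal S_k$ and $\mu_i^{(k)}=0$ for $i\in\mathcal E_k\setminus\mathcal S_k$ is feasible for Problem 2).
   Context: **Network.** $\mathcal G=(\mathcal V,\mathcal E)$ is a nonempty finite directed multigraph; edges are called cells. Each cell $i\in\mathcal E$ has tail $\sigma_i$ and head $\tau_i$ in $\mathcal V\cup\{w\}$, where $w$ is a virtual node representing the external world, and $\sigma_i\ne\tau_i$. On-ramps: $\mathcal O=\{i:\sigma_i=w\}$; off-ramps: $\mathcal S=\{i:\tau_i=w\}$. $\mathcal K$ is a nonempty finite set of commodities. Each $k\in\mathcal K$ has a set $\mathcal E_k\subseteq\mathcal E$ of utilizable cells; $\mathcal O_k=\mathcal O\cap\mathcal E_k$ and $\mathcal S_k=\mathcal S\cap\mathcal E_k$ are nonempty and every $i\in\mathcal E_k$ lies on a path (of utilizable cells) from some on-ramp in $\mathcal O_k$ to some off-ramp in $\mathcal S_k$. $\mathcal A_k=\{(i,j)\in\mathcal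 E_k\times\mathcal E_k:\tau_i=\sigma_j\ne w\}$. State space: $\mathcal X=\{x\in\mathbb R_+^{\mathcal E\times\mathcal K}: x_i^{(k)}=0\ \forall i\in\mathcal E\setminus\mathcal E_k\}$, with $x_i^{(k)}$ the volume of commodity $k$ on cell $i$. **Demand and supply.** Demand functions $d_i^{(k)}:\mathbb R_+\to\mathbb R_+$ ($k\in\mathcal K$, $i\in\mathcal E_k$) are continuously differentiable, concave, non-decreasing, with $d_i^{(k)}(0)=0$. Supply functions $s_i:\mathbb R_+\to\mathbb R_+$ are, for every $i\in\mathcal E\setminus\mathcal O$, continuously differentiable, concave and non-increasing. $w_i^{(k)}>0$ are given weights. **Inflows and controls.** Exogenous inflows $\lambda_i^{(k)}(t)\ge0$ for $i\in\mathcal O_k$, and $\lambda_i^{(k)}\equiv0$ for $i\in\mathcal E_k\setminus\mathcal O_k$. $\mathcal R^{(k)}$ is the set of matrices $M\in\mathbb R_+^{\mathcal E\times\mathcal E}$ with $\sum_{j\in\mathcal E}M_{ij}=1$ for $i\in\mathcal E_k\setminus\mathcal S_k$, $\sum_{j\in\mathcal E}M_{ij}=0$ for $i\in\mathcal S_k$, and $M_{ij}=0$ for $(i,j)\notin\mathcal A_k$. $\Omega=[0,1]^{\mathcal E\times\mathcal K}$. Controls are piecewise continuous functions $R^{(k)}:[0,T]\to\mathcal R^{(k)}$ ($k\in\mathcal K$) and $\alpha:[0,T]\to\Omega$; $R=(R^{(k)})_{k}$. **Dynamics.** For $k\in\mathcal K$, $i\in\mathcal E_k$: $\dot x_i^{(k)}=\lambda_i^{(k)}+\sum_{j\in\mathcal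 E_k}f_{ji}^{(k)}(x)-z_i^{(k)}(x)$, where $z_i^{(k)}=\sum_{j\in\mathcal E_k}f_{ij}^{(k)}$ if $i\in\mathcal E_k\setminus\mathcal S_k$, $z_i^{(k)}=\alpha_i^{(k)}d_i^{(k)}(x_i^{(k)})$ if $i\in\mathcal S_k$, and (FIFO rule) $f_{ij}^{(k)}=\gamma_i R_{ij}^{(k)}\alpha_i^{(k)}d_i^{(k)}(x_i^{(k)})$, with $\gamma_i=\gamma_i(x,\alpha,R)$ the largest $\tau\in[0,1]$ such that for every $j\in\mathcal E$ with $R_{ij}^{(k)}>0$ for some $k\in\mathcal K$: $\tau\sum_{k\in\mathcal K}\sum_{h\in\mathcal E_k}R_{hj}^{(k)}\alpha_h^{(k)}d_h^{(k)}(x_h^{(k)})\le s_j\big(\sum_{k\in\mathcal K}w_j^{(k)}x_j^{(k)}\big)$. **Problem 1 (continuous-time MC-DTA).** Minimize $J(\alpha,R)=\int_0^T\varphi(x(t),z(t))\,dt$ over controls $\alpha(t)\in\Omega$, $R^{(k)}(t)\in\mathcal R^{(k)}$, subject to the dynamics above with given initial condition $x(0)=x^0\in\mathcal X$. **Problem 2 (relaxation).** Variables: $\bar x^{(k)}(t)\in\mathbb R_+^{\mathcal E_k}$, $\bar f^{(k)}(t)\in\mathbb R_+^{\mathcal A_k}$ (with $\bar f_{ij}^{(k)}=0$ for $(i,j)\notin\mathcal A_k$), $\mu^{(k)}(t)\in\mathbb R_+^{\mathcal E_k}$ with $\mu_i^{(k)}=0$ for $i\in\mathcal E_k\setminus\mathcal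 S_k$; $\bar u=(\bar f,\mu)$. Minimize $\bar J(\bar x,\bar u)=\int_0^T\varphi(\bar x,\bar u)\,dt$ subject to, for all $k\in\mathcal K$, $i\in\mathcal E_k$: $\dot{\bar x}_i^{(k)}=\lambda_i^{(k)}(t)+\sum_{j\in\mathcal E_k}\bar f_{ji}^{(k)}-\sum_{j\in\mathcal E_k}\bar f_{ij}^{(k)}-\mu_i^{(k)}$, $\bar x(0)=x^0$, the demand constraints $\mu_i^{(k)}+\sum_{j\in\mathcal E_k}\bar f_{ij}^{(k)}\le d_i^{(k)}(\bar x_i^{(k)})$ ($k\in\mathcal K,i\in\mathcal E_k$) and the supply constraints $\sum_{k\in\mathcal K}\sum_{j\in\mathcal E_k}\bar f_{ji}^{(k)}\le s_i\big(\sum_{k\in\mathcal K}w_i^{(k)}\bar x_i^{(k)}\big)$ ($i\in\mathcal E$), at all times $t\in[0,T]$. The notation $\varphi(\bar x,\bar u)$ means $\varphi(\bar x,\bar z)$ with $\bar z_i^{(k)}=\mu_i^{(k)}+\sum_{j\in\mathcal E_k}\bar f_{ij}^{(k)}$. A problem is convex if its feasible set is convex and its objective is a convex function on it. *)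

(* Defs.v *)
(* MathComp-Analysis; the reals are an arbitrary [R : realType]. *)
From HB Require Import structures.
From mathcomp Require Import all_boot all_order all_algebra.
From mathcomp Require Import all_classical all_reals all_analysis.

Set Implicit Arguments.
Unset Strict Implicit.
Unset Printing Implicit Defensive.

Import Order.TTheory GRing.Theory Num.Theory.
Import numFieldNormedType.Exports.

Local Open Scope classical_set_scope.
Local Open Scope ring_scope.

Section real_analysis.
Variable R : realType.

(* [L] is the Frechet derivative of [f] at [a] relative to the set [A]; at a
   boundary point of [A] only increments that stay in [A] are considered.  On
   the finite-dimensional spaces used below a linear [L] is continuous. *)
Definition is_diff_within (V W : normedModType R) (A : set V) (f : V -> W)
    (a : V) (L : V -> W) : Prop :=
  let F := within A (nbhs a) in
  (fun y => f y - f a - L (y - a)) =o_F (fun y => y - a).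

(* Functions on [0, +oo[ are total functions [R -> R] of which only the values
   on [0, +oo[ are constrained. *)
Definition C1_nneg (f : R -> R) : Prop :=
  exists2 g : R -> R, {within `[0, +oo[, continuous g} &
    forall a : R, 0 <= a ->
      @is_diff_within R^o R^o `[0, +oo[ f a (fun h => g a * h).

Definition concave_nneg (f : R -> R) : Prop :=
  convex_function (`[0, +oo[ : set (convex_lmodType R^o)) (fun a => - f a).

Definition maps_nneg (f : R -> R) : Prop := forall a, 0 <= a -> 0 <= f a.

Definition piecewise_continuous (T : R) (g : R -> R) : Prop :=
  [/\ exists D : seq R,
        forall t, 0 < t < T -> t \notin D -> {for t, continuous g},
      forall t, 0 <= t < T -> cvg (g @ t^'+) &
      forall t, 0 < t <= T -> cvg (g @ t^'-)].

Definition absolutely_continuous (T : R) (y : R -> R) : Prop :=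
  forall e : R, 0 < e -> exists2 d : R, 0 < d &
    forall (n : nat) (u v : 'I_n -> R),
      (forall i, [/\ 0 <= u i, u i <= v i & v i <= T]) ->
      trivIset setT (fun i => `]u i, v i[%classic) ->
      \sum_i (v i - u i) < d ->
      \sum_i `|y (v i) - y (u i)| < e.

(* Caratheodory solutions on [0, T] of the equation y' = v: the controls may
   jump, and the flows they generate need not even be piecewise continuous. *)
Definition ode_solution (T : R) (y v : R -> R) : Prop :=
  absolutely_continuous T y /\
  {ae (@lebesgue_measure R), forall t, 0 < t < T -> is_derive t 1 y (v t)}.

End real_analysis.

(* The finite sets of cells and of commodities are enumerated, so that families
   of reals indexed by them are matrices.  The external world w is [None]. *)
Record network := Network {
  node : finType;
  ncell : nat;
  ncomm : nat;
  tail : 'I_ncell -> option node;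
  head : 'I_ncell -> option node;
  util : 'I_ncomm -> {set 'I_ncell} }.

Section network.
Variable N : network.
Local Notation cell := 'I_(ncell N).
Local Notation comm := 'I_(ncomm N).

Definition onramps : {set cell} := [set i | tail i == None].
Definition offramps : {set cell} := [set i | head i == None].

(* The set A_k of pairs of consecutive utilizable cells. *)
Definition adj (k : comm) : rel cell := fun i j =>
  [&& i \in util k, j \in util k, head i == tail j & tail j != None].

Definition network_axioms : Prop :=
  [/\ (0 < #|node N|)%N, (0 < ncomm N)%N,
      forall i : cell, tail i <> head i &
      forall k : comm,
        [/\ (onramps :&: util k != finset.set0)%SET,
            (offramps :&: util k != finset.set0)%SET &
            forall i, i \in util k ->
              exists (o : cell) (p : seq cell),
                [/\ o \in (onramps :&: util k)%SET, path (adj k) o p,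
                    last o p \in (offramps :&: util k)%SET & i \in o :: p]]].

End network.

(* [inflow] gives the exogenous inflows, [init] is the initial state x^0; rows
   of matrices are commodities and columns are cells.  [demand k i] and
   [inflow k i] are only meaningful when [i \in util k]. *)
Record traffic (R : realType) (N : network) := Traffic {
  demand : 'I_(ncomm N) -> 'I_(ncell N) -> R -> R;
  supply : 'I_(ncell N) -> R -> R;
  weight : 'M[R]_(ncomm N, ncell N);
  inflow : 'I_(ncomm N) -> 'I_(ncell N) -> R -> R;
  horizon : R;
  init : 'M[R]_(ncomm N, ncell N) }.

Section traffic.
Variables (R : realType) (N : network) (P : traffic R N).
Local Notation cell := 'I_(ncell N).
Local Notation comm := 'I_(ncomm N).
Local Notation state := 'M[R]_(ncomm N, ncell N).
Local Notation routing := (comm -> 'M[R]_(ncell N)).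
Local Notation T := (horizon P).
Local Notation mu := (@lebesgue_measure R).

Definition state_space : set state :=
  [set x : state | (forall k i, 0 <= x k i) /\
           (forall k i, i \notin util k -> x k i = 0)].

Definition traffic_axioms : Prop :=
  [/\ forall k i, i \in util k ->
        [/\ maps_nneg (demand P k i), C1_nneg (demand P k i),
            concave_nneg (demand P k i),
            {in `[0, +oo[ &, {homo demand P k i : a b / a <= b}} &
            demand P k i 0 = 0],
      (forall i, maps_nneg (supply P i)) /\
      (forall i, i \notin onramps N ->
        [/\ C1_nneg (supply P i), concave_nneg (supply P i) &
            {in `[0, +oo[ &, {homo supply P i : a b / a <= b >-> b <= a}}]),
      forall k i, 0 < weight P k i,
      forall k i t, 0 <= t <= T -> i \in util k ->
        (i \in onramps N -> 0 <= inflow P k i t) /\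
        (i \notin onramps N -> inflow P k i t = 0) &
      0 <= T /\ state_space (init P)].

Definition routing_matrices (k : comm) : set 'M[R]_(ncell N) :=
  [set M : 'M[R]_(ncell N) | [/\ forall i j, 0 <= M i j,
               forall i, i \in (util k :\: offramps N)%SET ->
                 \sum_j M i j = 1,
               forall i, i \in (offramps N :&: util k)%SET ->
                 \sum_j M i j = 0 &
               forall i j, ~~ adj k i j -> M i j = 0]].

Definition control_set : set state :=
  [set a : state | forall k i, 0 <= a k i <= 1].

Definition cell_supply (x : state) (j : cell) : R :=
  supply P j (\sum_k weight P k j * x k j).

Definition fifo_feasible (x a : state) (r : routing) (i : cell) : set R :=
  [set tau : R | 0 <= tau <= 1 /\
     forall j, (exists k, 0 < r k i j) ->
       tau * \sum_k \sum_(h in util k) r k h j * a k h * demand P k h (x k h)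
         <= cell_supply x j].

(* The largest element of [fifo_feasible x a r i]. *)
Definition fifo_gamma (x a : state) (r : routing) (i : cell) : R :=
  xget 0 (fifo_feasible x a r i `&` ubound (fifo_feasible x a r i)).

Definition flow (x a : state) (r : routing) : routing := fun k =>
  \matrix_(i, j)
    (fifo_gamma x a r i * r k i j * a k i * demand P k i (x k i)).

Definition outflow (x a : state) (r : routing) : state :=
  \matrix_(k, i)
    (if i \in util k then
       if i \in offramps N then a k i * demand P k i (x k i)
       else \sum_(j in util k) flow x a r k i j
     else 0).

Definition feasible1 (a : R -> state) (r : R -> routing) (x : R -> state) :
    Prop :=
  [/\ forall k i, piecewise_continuous T (fun t => a t k i),
      forall k i j, piecewise_continuous T (fun t => r t k i j),
      forall t, 0 <= t <= T ->
        control_set (a t) /\ forall k, routing_matrices k (r t k),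
      x 0 = init P /\ forall t, 0 <= t <= T -> state_space (x t) &
      forall k i, i \in util k ->
        ode_solution T (fun t => x t k i)
          (fun t => inflow P k i t
             + \sum_(j in util k) flow (x t) (a t) (r t) k j i
             - outflow (x t) (a t) (r t) k i)].

(* Trajectories (xbar, fbar, mu) of the relaxed problem. *)
Definition relaxed : lmodType R :=
  ((R -> state) * (R -> routing) * (R -> state))%type.

Definition relaxed_outflow (f : routing) (m : state) : state :=
  \matrix_(k, i)
    (if i \in util k then m k i + \sum_(j in util k) f k i j else 0).

(* Measurability of fbar and mu is the least regularity that gives a meaning to
   the cost integral; it holds for the flows generated by piecewise continuous
   controls, which need not be piecewise continuous themselves. *)
Definition feasible2 : set relaxed :=
  [set y : relaxed |
    let x : R -> state := y.1.1 in
    let f : R -> routing := y.1.2 in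
    let m : R -> state := y.2 in
    [/\ (forall k i j, measurable_fun `[0, T] (fun t => f t k i j)) /\
        (forall k i, measurable_fun `[0, T] (fun t => m t k i)),
        x 0 = init P,
        forall t, 0 <= t <= T ->
          [/\ state_space (x t),
              forall k i j, 0 <= f t k i j,
              forall k i j, ~~ adj k i j -> f t k i j = 0,
              forall k i, 0 <= m t k i &
              forall k i, i \notin (offramps N :&: util k)%SET ->
                m t k i = 0],
        forall t, 0 <= t <= T ->
          (forall k i, i \in util k ->
             m t k i + \sum_(j in util k) f t k i j <= demand P k i (x t k i))
          /\
          (forall i, \sum_k \sum_(j in util k) f t k j i
                       <= cell_supply (x t) i) &
        forall k i, i \in util k ->
          ode_solution T (fun t => x t k i)
            (fun t => inflow P k i t + \sum_(j in util k) f t k j i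
               - \sum_(j in util k) f t k i j - m t k i)]].

(* The relaxed trajectory attached to controls and state of the original
   problem. *)
Definition relaxation (a : R -> state) (r : R -> routing) (x : R -> state) :
    relaxed :=
  (x, fun t => flow (x t) (a t) (r t),
   fun t => \matrix_(k, i)
     (if i \in (offramps N :&: util k)%SET
      then outflow (x t) (a t) (r t) k i else 0)).

Section cost.
Variable phi : state * state -> R.

Definition cost_domain : set (state * state) :=
  [set q : state * state | (forall k i, 0 <= q.1 k i) /\ (forall k i, 0 <= q.2 k i)].

(* Since [cost_domain] has nonempty interior, the derivative [L] at each of its
   points is unique, and its values on the unit matrices are the partial
   derivatives of [phi]. *)
Definition cost_axioms : Prop :=
  [/\ convex_function (cost_domain : set (convex_lmodType (state * state)%type))
        phi,
      forall q, cost_domain q ->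
        exists L : {linear (state * state)%type -> R},
          [/\ is_diff_within cost_domain phi q L,
              forall k i, 0 <= L (delta_mx k i, 0) &
              forall k i, L (0, delta_mx k i) <= 0] &
      phi (0, 0) = 0].

Definition running_cost2 (y : relaxed) (t : R) : R :=
  phi (y.1.1 t, relaxed_outflow (y.1.2 t) (y.2 t)).

Definition cost2 (y : relaxed) : R :=
  \int[mu]_(t in `[0, T]) running_cost2 y t.

(* [Rintegral] is total, so that the objective is a genuine real-valued function
   on the feasible set is a separate clause. *)
Definition convex_problem2 : Prop :=
  [/\ convex_set (feasible2 : set (convex_lmodType relaxed)),
      forall y, feasible2 y ->
        mu.-integrable `[0, T] (EFin \o running_cost2 y) &
      convex_function (feasible2 : set (convex_lmodType relaxed)) cost2].

End cost.

End traffic.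

(* Main.v *)
Require Import Defs.
From mathcomp Require Import all_boot all_order all_algebra.
From mathcomp Require Import all_classical all_reals all_analysis.
From mathcomp Require Import unstable measurable_realfun ring lra.

(** Convexity of the relaxed problem.  Its dynamics are affine in volumes and
    flows, and its inequality constraints bound linear functions of the flows by
    concave functions of the volumes, so convex combinations of trajectories
    stay feasible ([convex_feasible2]).  Supply functions of on-ramps need not
    be concave, but on-ramps have no upstream cell, so that their supply
    constraint only asks for a nonnegative supply.

    The objective is convex because the outflow is linear in the flows and the
    integral is linear and monotone, once the running cost is known to be
    integrable ([feasible2_integrable]).  Volumes are bounded because they are
    continuous on a compact interval, and outflows because demands are
    nondecreasing in the volumes; the signs of the partial derivatives and the
    tangent inequality of convex functions ([convex_tangent]) make the cost
    nondecreasing in the volumes and nonincreasing in the outflows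
    ([cost_monotone]), hence bounded on any box.  The running cost is measurable
    because the cost is continuous on its domain: it is the pointwise limit of
    its values at volumes and outflows rounded down to a grid of mesh [1/k],
    which are countably many ([measurable_cost]).

    Feasibility of the trajectories of the original problem.  Scaling by the
    FIFO coefficient and by the controls keeps outflows below demands.  If cell
    [i] receives a positive share of the flow leaving [j], the coefficient of
    [j] is at most the ratio of the supply of [i] to the controlled demand
    routed to [i], capped at 1, so the flow entering [i] is at most its supply
    ([inflow_le_supply]).  The flows are measurable in time because the FIFO
    coefficient is the minimum of 1 and of finitely many such ratios
    ([fifo_gammaE]), which depend measurably on volumes and controls. *)

Set Implicit Arguments.
Unset Strict Implicit.
Unset Printing Implicit Defensive.

Import Order.TTheory GRing.Theory Num.Theory.
Import numFieldNormedType.Exports.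

Local Open Scope classical_set_scope.
Local Open Scope ring_scope.
Local Open Scope convex_scope.

(** * Absolutely continuous and piecewise continuous functions *)

Section real_functions.
Variable R : realType.
Implicit Types (T p q : R) (y v g : R -> R).

(** The case of a single interval in the definition of absolute continuity. *)
Lemma absolutely_continuous_modulus T y : absolutely_continuous T y ->
  forall e, 0 < e -> exists2 d, 0 < d &
    forall s t, 0 <= s <= T -> 0 <= t <= T -> `|s - t| < d -> `|y s - y t| < e.
Proof.
move=> ac e e0; have [d d0 acd] := ac e e0; exists d => // s t.
wlog ts : s t / t <= s.
  move=> H sT tT st; have [/H|/ltW/H] := leP t s; first exact.
  by rewrite distrC [X in _ -> _ -> _ -> X < _]distrC; apply.
move=> /andP[s0 sT] /andP[t0 tT]; rewrite ger0_norm ?subr_ge0// => std.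
have := acd 1%N (fun=> t) (fun=> s); rewrite !big_ord1; apply => //.
by move=> i j _ _ _; rewrite !ord1.
Qed.

Lemma absolutely_continuous_within T y : absolutely_continuous T y ->
  {within `[0, T], continuous y}.
Proof.
move=> ac; apply/subspace_continuousP => s /=; rewrite in_itv/= => sT.
apply/cvgrPdist_lt => e /(absolutely_continuous_modulus ac)[d d0 acd].
rewrite near_withinE; near=> t; rewrite /= in_itv/= => tT.
by apply: acd => //; near: t; exists d.
Unshelve. all: by end_near. Qed.

Lemma absolutely_continuous_lin T p q y1 y2 :
  absolutely_continuous T y1 -> absolutely_continuous T y2 ->
  absolutely_continuous T (fun t => p * y1 t + q * y2 t).
Proof.
move=> ac1 ac2 e e0.
have M0 (a : R) : 0 < 2 * (`|a| + 1) by rewrite mulr_gt0// ltr_wpDl.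
have [d1 d10 H1] := ac1 (e / (2 * (`|p| + 1))) (divr_gt0 e0 (M0 p)).
have [d2 d20 H2] := ac2 (e / (2 * (`|q| + 1))) (divr_gt0 e0 (M0 q)).
exists (Num.min d1 d2); first by rewrite lt_min d10.
move=> n u v uv tuv; rewrite lt_min => /andP[/(H1 _ _ _ uv tuv) {}H1].
move=> /(H2 _ _ _ uv tuv) {}H2.
(* Each term gets half of [e]; the denominators carry [+ 1] because the
   coefficients may vanish. *)
have half (a S : R) : 0 <= S -> S < e / (2 * (`|a| + 1)) -> `|a| * S < e / 2.
  move=> S0; rewrite ltr_pdivlMr// => Se; rewrite ltr_pdivlMr//.
  apply: le_lt_trans Se; rewrite -mulrA mulrCA ler_wpM2l// mulrC.
  by rewrite ler_wpM2l// lerDl.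
rewrite (splitr e); apply: le_lt_trans (ltrD (half _ _ _ H1) (half _ _ _ H2)).
- rewrite !mulr_sumr -big_split ler_sum// => i _ /=.
  by rewrite -!normrM !mulrBr opprD addrACA ler_normD.
- exact: sumr_ge0.
- exact: sumr_ge0.
Qed.

Lemma ode_solution_lin T p q y1 y2 v1 v2 :
  ode_solution T y1 v1 -> ode_solution T y2 v2 ->
  ode_solution T (fun t => p * y1 t + q * y2 t) (fun t => p * v1 t + q * v2 t).
Proof.
move=> [ac1 d1] [ac2 d2]; split; first exact: absolutely_continuous_lin.
pose F := ae_filter_ringOfSetsType (@lebesgue_measure R).
apply: (@filterS2 _ _ F _ _ _ _ d1 d2) => t H1 H2 tT.
have D1 := H1 tT; have D2 := H2 tT.
exact: (is_deriveD (is_deriveZ _ D1) (is_deriveZ _ D2)).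
Qed.

Lemma ode_solution_eq T y v1 v2 : (forall t, 0 < t < T -> v1 t = v2 t) ->
  ode_solution T y v1 -> ode_solution T y v2.
Proof.
move=> v12 [ac d]; split => //.
pose F := ae_filter_ringOfSetsType (@lebesgue_measure R).
apply: (@filterS _ _ F _ _ _ d) => t H tT.
by rewrite -v12//; exact: H.
Qed.

(** Outside the exceptional points [g] is continuous on an open set, and on the
    finitely many exceptional points every function is measurable; the values at
    the ends of the interval do not matter for the same reason. *)
Lemma continuous_except_measurable T g (D : seq R) :
  (forall t, 0 < t < T -> t \notin D -> {for t, continuous g}) ->
  measurable_fun `[0, T] g.
Proof.
move=> cg; apply: (@measurable_fun_itv_cc _ _ _ false true).
have mD : measurable [set` D].
  by apply: countable_measurable => //; exact/finite_set_countable/finite_seq.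
rewrite -[X in measurable_fun X _](setUIDK _ [set` D]).
apply/measurable_funU; [exact: measurableI|exact: measurableD|split].
  move=> _ Y mY; apply: countable_measurable => //.
  exact/finite_set_countable/finite_setIl/finite_setIr/finite_seq.
apply: open_continuous_measurable_fun.
  rewrite setDE; apply: openI; first exact: interval_open.
  apply: closed_openC; apply: compact_closed; first exact: Rhausdorff.
  exact/finite_compact/finite_seq.
move=> t; rewrite inE/= in_itv/= => -[tT tD]; apply: cg => //.
exact/negP.
Qed.

Lemma piecewise_continuous_measurable T g :
  piecewise_continuous T g -> measurable_fun `[0, T] g.
Proof. by move=> [[D cg] _ _]; exact: continuous_except_measurable cg. Qed.

Lemma absolutely_continuous_measurable T y :
  absolutely_continuous T y -> measurable_fun `[0, T] y.
Proof.
move=> /absolutely_continuous_within; exact: subspace_continuous_measurable_fun.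
Qed.

Lemma absolutely_continuous_bounded T y : 0 <= T ->
  absolutely_continuous T y ->
  exists2 M, 0 <= M & forall t, 0 <= t <= T -> y t <= M.
Proof.
move=> T0 /absolutely_continuous_within/(EVT_max T0)[c _ maxc].
exists `|y c| => // t tT; apply: le_trans (ler_norm _).
by apply: maxc; rewrite in_itv.
Qed.

(** Monotonicity on the half-line is enough: replacing [g] by [g] of the positive
    part gives a function that is nondecreasing on the whole line and agrees
    with [g] on the values of [h]. *)
Lemma measurable_comp_nondecreasing_nneg (D : set R) g (h : R -> R) :
  {in `[0, +oo[ &, {homo g : a b / a <= b}} -> measurable D ->
  (forall t, D t -> 0 <= h t) -> measurable_fun D h ->
  measurable_fun D (g \o h).
Proof.
move=> gnd mD h0 mh.
apply: (@eq_measurable_fun _ _ _ _ D ((fun a => g (Num.max 0 a)) \o h)).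
  by move=> t; rewrite inE => /h0 ht; rewrite /= max_r.
apply: (measurable_comp measurableT) => //.
apply: nondecreasing_measurable => // a b ab.
by apply: gnd; rewrite ?in_itv/= ?andbT ?ge_max !le_max lexx ?ab ?orbT.
Qed.

Lemma measurable_sum_cond (D : set R) (I : finType) (A : pred I) (h : I -> R -> R) :
  (forall i, A i -> measurable_fun D (h i)) ->
  measurable_fun D (fun t => \sum_(i | A i) h i t).
Proof.
move=> mh; under eq_fun do rewrite big_mkcond.
apply: measurable_sum => i; case: (boolP (A i)) => [/mh//|_].
exact: measurable_cst.
Qed.

End real_functions.

(** * Tangent inequality for convex functions on a convex set *)

Section differentiable_convex.
Variables (R : realType) (V : normedModType R).
Implicit Types (A : set V) (f L : V -> R) (a b : V).

Lemma is_diff_withinP A f a L : is_diff_within A f a L ->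
  forall e, 0 < e -> exists2 d, 0 < d &
    forall b, A b -> `|b - a| < d ->
      `|f b - f a - L (b - a)| <= e * `|b - a|.
Proof.
move=> /eqoP dL e /dL; rewrite near_withinE => /nbhs_normP[d d0 dP].
by exists d => // b Ab ba; apply: dP => //=; rewrite distrC.
Qed.

(** Convexity bounds the increment of [f] along the segment from [a] to [b] by
    [t] times [f b - f a], whereas differentiability makes it [t * L (b - a)] up
    to [o(t)]; dividing by [t] gives the inequality. *)
Lemma convex_tangent A f a L b :
  convex_set (A : set (convex_lmodType V)) ->
  convex_function (A : set (convex_lmodType V)) f ->
  is_diff_within A f a L -> (forall t v, L (t *: v) = t * L v) ->
  A a -> A b -> L (b - a) <= f b - f a.
Proof.
move=> Acvx fcvx /is_diff_withinP dL LZ Aa Ab.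
apply/ler_addgt0Pl => e e0.
have n0 : 0 < `|b - a| + 1 by rewrite ltr_wpDl.
have [d d0 dP] := dL (e / (`|b - a| + 1)) (divr_gt0 e0 n0).
(* This [t] keeps [a + t *: (b - a)] on the segment and closer to [a] than [d]. *)
pose t := Num.min 1 (d / (`|b - a| + 1) / 2).
have t0 : 0 < t by rewrite lt_min ltr01/= !divr_gt0.
have t1 : t <= 1 by rewrite ge_min lexx.
pose p := Itv01 (ltW t0) t1.
have Ay := Acvx b a p (mem_set Ab) (mem_set Aa).
have fy := fcvx p b a (mem_set Ab) (mem_set Aa).
have yE : (b : convex_lmodType V) <| p |> a = a + t *: (b - a) :> V.
  by rewrite /conv/= /onem scalerBl scale1r scalerBr addrCA.
move: fy; rewrite yE convRE/= /onem => fy.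
have := dP (a + t *: (b - a)).
rewrite -yE => /(_ (set_mem Ay)).
rewrite yE addrAC subrr add0r LZ normrZ gtr0_norm//.
have td : t * `|b - a| < d.
  apply: (@le_lt_trans _ _ (d / (`|b - a| + 1) / 2 * (`|b - a| + 1))).
    by apply: ler_pM => //; [exact: ltW|rewrite ge_min lexx orbT|rewrite lerDl].
  rewrite mulrAC divfK ?gt_eqF// ltr_pdivrMr//; lra.
move=> /(_ td); rewrite ler_norml => /andP[H _].
have et : e / (`|b - a| + 1) * (t * `|b - a|) <= t * e.
  by rewrite mulrCA ler_pM2l// mulrAC ler_pdivrMr// ler_pM2l// lerDl.
rewrite -(ler_pM2l t0); lra.
Qed.

End differentiable_convex.

(** * Continuity and monotonicity of the cost *)

Section matrix_pairs.
Variables (R : realType) (m n : nat).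
Implicit Types x z : 'M[R]_(m, n).

Lemma normr_mx_entry x i j : `|x i j| <= `|x|.
Proof.
rewrite [leRHS]/Num.norm/= mx_normE.
by rewrite -[leLHS]nngE num_le; exact: (le_bigmax _ _ (i, j)).
Qed.

Lemma normr_mx_le x e : 0 <= e -> (forall i j, `|x i j| <= e) -> `|x| <= e.
Proof.
move=> /nonnegP[{}e] xe; rewrite [leLHS]/Num.norm/= mx_normE num_le.
by apply/bigmax_leP; split => [|[i j] _]; rewrite -num_le/=.
Qed.

Lemma linear_mx_pairE (L : {linear ('M[R]_(m, n) * 'M[R]_(m, n))%type -> R}) x z :
  L (x, z) = \sum_i \sum_j (x i j * L (delta_mx i j, 0) +
                            z i j * L (0, delta_mx i j)).
Proof.
have LD y y' : L (y + y') = L y + L y' by exact: raddfD.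
have L0 : L (0, 0) = 0 by exact: raddf0.
have -> : (x, z) = (x, 0) + (0, z) :> ('M[R]_(m, n) * 'M[R]_(m, n))%type.
  by congr pair; rewrite /= ?addr0 ?add0r.
rewrite LD.
have Dl : {morph (fun y => L (y, 0)) : y y' / y + y'}.
  by move=> y y'; rewrite -LD; congr (L (_, _)); rewrite /= addr0.
have Dr : {morph (fun y => L (0, y)) : y y' / y + y'}.
  by move=> y y'; rewrite -LD; congr (L (_, _)); rewrite /= addr0.
rewrite {1}[x]matrix_sum_delta {1}[z]matrix_sum_delta.
rewrite (big_morph _ Dl L0) (big_morph _ Dr L0) -big_split.
apply: eq_bigr => i _ /=; rewrite (big_morph _ Dl L0) (big_morph _ Dr L0).
rewrite -big_split; apply: eq_bigr => j _ /=; congr (_ + _).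
  have -> : (x i j *: delta_mx i j, 0) = x i j *: (delta_mx i j, 0)
      :> ('M[R]_(m, n) * 'M[R]_(m, n))%type.
    by congr pair; rewrite /= scaler0.
  by rewrite linearZ.
have -> : (0, z i j *: delta_mx i j) = z i j *: (0, delta_mx i j)
    :> ('M[R]_(m, n) * 'M[R]_(m, n))%type.
  by congr pair; rewrite /= scaler0.
by rewrite linearZ.
Qed.

Lemma linear_mx_pair_bounded
    (L : {linear ('M[R]_(m, n) * 'M[R]_(m, n))%type -> R}) :
  exists2 C, 0 <= C & forall q, `|L q| <= C * `|q|.
Proof.
exists (\sum_i \sum_j (`|L (delta_mx i j, 0)| + `|L (0, delta_mx i j)|)).
  by apply: sumr_ge0 => i _; apply: sumr_ge0 => j _; exact: addr_ge0.
move=> [x z]; rewrite linear_mx_pairE mulr_suml.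
apply: le_trans (ler_norm_sum _ _ _) _; apply: ler_sum => i _.
rewrite mulr_suml.
apply: le_trans (ler_norm_sum _ _ _) _; apply: ler_sum => j _.
apply: le_trans (ler_normD _ _) _; rewrite !normrM mulrDl.
rewrite ![`|_| * `|L _|]mulrC prod_normE/=.
by rewrite lerD// ler_wpM2l// (le_trans (normr_mx_entry _ i j))// le_max lexx ?orbT.
Qed.

(** A linear map on pairs of matrices is bounded, so the derivative controls the
    increments of [f] near [a]; [f] is thus continuous along [A]. *)
Lemma is_diff_within_cvg (A : set ('M[R]_(m, n) * 'M[R]_(m, n))) f a
    (L : {linear ('M[R]_(m, n) * 'M[R]_(m, n))%type -> R})
    (u : nat -> 'M[R]_(m, n) * 'M[R]_(m, n)) :
  is_diff_within A f a L -> (forall k, A (u k)) ->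
  u k @[k --> \oo] --> a -> f (u k) @[k --> \oo] --> f a.
Proof.
move=> /is_diff_withinP/(_ 1 ltr01)[d d0 dP] Au /cvgrPdistC_lt ua.
have [C C0 LC] := linear_mx_pair_bounded L.
apply/cvgrPdistC_lt => e e0.
have C10 : 0 < C + 1 by rewrite ltr_wpDl.
near=> k.
have kd : `|u k - a| < d by near: k; exact: ua.
have ke : `|u k - a| < e / (C + 1) by near: k; apply: ua; exact: divr_gt0.
have H := dP _ (Au k) kd.
rewrite -[_ - _](subrK (L (u k - a))).
apply: le_lt_trans (ler_normD _ _) _.
apply: le_lt_trans (lerD H (LC _)) _.
by rewrite -mulrDl addrC mulrC -ltr_pdivlMr.
Unshelve. all: by end_near. Qed.

End matrix_pairs.

Section cost.
Variables (R : realType) (N : network).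
Local Notation state := 'M[R]_(ncomm N, ncell N).
Variable phi : state * state -> R.
Hypothesis hphi : cost_axioms phi.
Local Notation cost_domain := (@cost_domain R N).

Lemma convex_cost_domain :
  convex_set (cost_domain : set (convex_lmodType (state * state)%type)).
Proof.
move=> q q' p; rewrite !inE => -[q1 q2] [q1' q2'].
have p0 : 0 <= p%:num by []; have p1 : 0 <= p%:num.~ by rewrite onem_ge0.
by split => k i; rewrite /= !mxE addr_ge0 ?mulr_ge0.
Qed.

(** By the tangent inequality at [q], [phi q' - phi q] is at least [L (q' - q)],
    where [L] has coefficients of the sign of the corresponding increments. *)
Lemma cost_monotone q q' : cost_domain q -> cost_domain q' ->
  (forall k i, q.1 k i <= q'.1 k i) -> (forall k i, q'.2 k i <= q.2 k i) ->
  phi q <= phi q'.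
Proof.
have [phicvx phid _] := hphi => Dq Dq' q1 q2.
have [L [dL L1 L2]] := phid q Dq.
rewrite -subr_ge0.
apply: le_trans (convex_tangent convex_cost_domain phicvx dL _ Dq Dq').
  rewrite [q' - q]surjective_pairing linear_mx_pairE.
  apply: sumr_ge0 => k _; apply: sumr_ge0 => i _; rewrite addr_ge0//.
    by rewrite mulr_ge0// !mxE subr_ge0.
  by rewrite mulr_le0// !mxE subr_le0.
by move=> t v; rewrite linearZ.
Qed.

Lemma cost_cvg q (u : nat -> state * state) : cost_domain q ->
  (forall k, cost_domain (u k)) ->
  u k @[k --> \oo] --> q -> phi (u k) @[k --> \oo] --> phi q.
Proof.
move=> Dq Du uq; have [_ phid _] := hphi; have [L [dL _ _]] := phid q Dq.
exact: is_diff_within_cvg dL Du uq.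
Qed.

End cost.

(** * Integrability of the running cost *)

Section discretization.
Variable R : realType.
Implicit Types D : set R.

(** Every preimage is a countable union of level sets of [c]. *)
Lemma measurable_fun_countable D (U : countType) (c : R -> U) (F : U -> R) :
  (forall u, measurable (D `&` [set t | c t = u])) ->
  measurable_fun D (F \o c).
Proof.
move=> mc _ Y _.
have -> : D `&` (F \o c) @^-1` Y =
    \bigcup_u (if `[< Y (F u) >] then D `&` [set t | c t = u] else set0).
  apply/seteqP; split=> [t [Dt Yt]|t [u _]].
    by exists (c t) => //; case: ifPn => // /asboolP.
  by case: ifPn => // /asboolP YFu [Dt ctu]; split => //=; rewrite ctu.
apply: countable_bigcupT_measurable => [|u]; first exact: countableP.
by case: ifP.
Qed.

(** Entrywise rounding down to multiples of [1 / k.+1]; [of_grid] recovers the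
    grid point, and rounding down preserves nonnegativity. *)
Definition to_grid m n (k : nat) (v : 'M[R]_(m, n)) : 'M[nat]_(m, n) :=
  \matrix_(i, j) Num.truncn (v i j * k.+1%:R).

Definition of_grid m n (k : nat) (c : 'M[nat]_(m, n)) : 'M[R]_(m, n) :=
  \matrix_(i, j) ((c i j)%:R / k.+1%:R).

Lemma of_grid_ge0 m n k (c : 'M[nat]_(m, n)) i j : 0 <= of_grid k c i j.
Proof. by rewrite mxE divr_ge0. Qed.

Lemma to_gridK_dist m n k (v : 'M[R]_(m, n)) : (forall i j, 0 <= v i j) ->
  `|v - of_grid k (to_grid k v)| <= k.+1%:R^-1.
Proof.
move=> v0; apply: normr_mx_le => [|i j]; first by rewrite invr_ge0.
have k0 : 0 < k.+1%:R :> R by rewrite ltr0n.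
have vk0 : 0 <= v i j * k.+1%:R by rewrite mulr_ge0.
have /andP[c1 c2] := truncn_itv vk0.
rewrite !mxE ger0_norm ?subr_ge0 ?ler_pdivrMr//.
by rewrite lerBlDl -[X in _ + X]mul1r -mulrDl natr1 ler_pdivlMr// ltW.
Qed.

Lemma measurable_to_grid_level m n k D (v : R -> 'M[R]_(m, n)) c :
  measurable D -> (forall i j, measurable_fun D (fun t => v t i j)) ->
  (forall t, D t -> forall i j, 0 <= v t i j) ->
  measurable (D `&` [set t | to_grid k (v t) = c]).
Proof.
move=> mD mv v0.
have -> : D `&` [set t | to_grid k (v t) = c] =
    D `&` \bigcap_(ij in [set: 'I_m * 'I_n])
      (D `&` (fun t => v t ij.1 ij.2 * k.+1%:R) @^-1`
         `[(c ij.1 ij.2)%:R, (c ij.1 ij.2).+1%:R[).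
  apply/seteqP; split=> t /= [Dt H]; split=> //.
    move=> [i j] _; split=> //=; rewrite in_itv/= -H mxE truncn_itv//.
    by rewrite mulr_ge0// v0.
  apply/matrixP => i j; have [_ /=] := H (i, j) I.
  by rewrite in_itv/= mxE -truncn_eq ?mulr_ge0 ?v0// => /eqP.
apply: measurableI => //; apply: fin_bigcap_measurable => // -[i j] _.
by apply: measurable_funM => //; exact: measurable_cst.
Qed.

End discretization.

Section cost_integrable.
Variables (R : realType) (N : network).
Local Notation state := 'M[R]_(ncomm N, ncell N).
Variable phi : state * state -> R.
Hypothesis hphi : cost_axioms phi.

(** Countably many grid points approximate the arguments of [phi], so the
    approximations have countably many measurable level sets; continuity of [phi] on
    the nonnegative matrices gives their pointwise convergence. *)
Lemma measurable_cost (D : set R) (x z : R -> state) : measurable D ->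
  (forall k i, measurable_fun D (fun t => x t k i)) ->
  (forall k i, measurable_fun D (fun t => z t k i)) ->
  (forall t, D t -> cost_domain (x t, z t)) ->
  measurable_fun D (fun t => phi (x t, z t)).
Proof.
move=> mD mx mz xz0.
pose grid_state := 'M[nat]_(ncomm N, ncell N).
pose g k (c : grid_state * grid_state) : state * state :=
  (of_grid R k c.1, of_grid R k c.2).
pose h k t := (to_grid k (x t), to_grid k (z t)).
apply: (@measurable_fun_cvg _ _ _ D (fun k t => phi (g k (h k t)))) => [k|t Dt].
  apply: (@measurable_fun_countable _ _ _ (h k) (phi \o g k)) => -[c1 c2].
  have -> : D `&` [set t | h k t = (c1, c2)] =
      (D `&` [set t | to_grid k (x t) = c1]) `&`
      (D `&` [set t | to_grid k (z t) = c2]).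
    apply/seteqP; split=> t /=; first by case=> Dt [<- <-].
    by move=> [[Dt <-] [_ <-]].
  by apply: measurableI; apply: measurable_to_grid_level => // t /xz0[].
have [x0 z0] := xz0 _ Dt.
apply: (cost_cvg hphi) => [|k|]; first exact: xz0.
  by split => k' i; exact: of_grid_ge0.
apply/cvgrPdist_le => e e0; near=> k.
apply: (@le_trans _ _ k.+1%:R^-1).
  by rewrite prod_normE ge_max; apply/andP; split; exact: to_gridK_dist.
by apply: ltW; near: k; exact: (near_infty_natSinv_lt (PosNum e0)).
Unshelve. all: by end_near. Qed.

(** On a box, monotonicity places [phi] between its values at the corner of
    empty cells with largest outflows and at the corner of full cells with no
    outflow. *)
Lemma integrable_cost (T M : R) (x z : R -> state) :
  (forall k i, measurable_fun `[0, T] (fun t => x t k i)) ->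
  (forall k i, measurable_fun `[0, T] (fun t => z t k i)) ->
  (forall t, 0 <= t <= T -> forall k i, 0 <= x t k i <= M /\ 0 <= z t k i <= M) ->
  (@lebesgue_measure R).-integrable `[0, T] (EFin \o (fun t => phi (x t, z t))).
Proof.
move=> mx mz xzM.
have D0 t : `[0, T]%classic t -> cost_domain (x t, z t).
  move=> /=; rewrite in_itv/= => /xzM H.
  by split=> k i /=; have [/andP[x0 _] /andP[z0 _]] := H k i.
apply: measurable_bounded_integrable => //=.
- by rewrite lebesgue_measure_itv/=; case: ifP => _; rewrite ltry.
- exact: measurable_cost.
pose lo : state * state := (0, const_mx `|M|).
pose hi : state * state := (const_mx `|M|, 0).
exists (Num.max `|phi lo| `|phi hi|); split; first exact: num_real.
move=> B MB t Dt; have tT : 0 <= t <= T by move: Dt; rewrite /= in_itv.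
have Dlo : cost_domain lo by split=> k i; rewrite !mxE.
have Dhi : cost_domain hi by split=> k i; rewrite !mxE.
have MM a : 0 <= a <= M -> a <= `|M|.
  by move=> /andP[_ aM]; exact: le_trans aM (ler_norm _).
have /xzM H := tT.
have Dt0 := D0 _ Dt.
have /ltW := MB; rewrite ge_max => /andP[loB hiB].
rewrite /= ler_norml; apply/andP; split.
  rewrite lerNl; apply: le_trans loB; rewrite -normrN; apply: le_trans (ler_norm _).
  rewrite lerN2; apply: (cost_monotone hphi) => //= k i; have [xM zM] := H k i.
    by rewrite mxE; case/andP: xM.
  by rewrite mxE MM.
apply: le_trans hiB; apply: le_trans (ler_norm _).
apply: (cost_monotone hphi) => //= k i; have [xM zM] := H k i.
  by rewrite mxE MM.
by rewrite mxE; case/andP: zM.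
Qed.

End cost_integrable.

(** * Convexity of the feasible set of the relaxed problem *)

Lemma concave_nnegP (R : realType) (d : R -> R) (p : {i01 R}) a b :
  concave_nneg d -> 0 <= a -> 0 <= b ->
  p%:num * d a + p%:num.~ * d b <= d (p%:num * a + p%:num.~ * b).
Proof.
move=> dcve a0 b0.
have := dcve p a b; rewrite !inE/= !in_itv/= !andbT => /(_ a0 b0).
by rewrite convRE !mulrN -opprD lerN2.
Qed.

Section relaxed_problem.
Variables (R : realType) (N : network) (P : traffic R N).
Hypothesis hP : traffic_axioms P.
Local Notation cell := 'I_(ncell N).
Local Notation comm := 'I_(ncomm N).
Local Notation state := 'M[R]_(ncomm N, ncell N).
Local Notation T := (horizon P).
Local Notation relaxed := (relaxed R N).
Local Notation conv2 := (@conv R (convex_lmodType relaxed)).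
Implicit Types (y : relaxed) (p : {i01 R}).

Lemma conv_volume p y1 y2 t k i : (conv2 p y1 y2).1.1 t k i =
  p%:num * y1.1.1 t k i + p%:num.~ * y2.1.1 t k i.
Proof. by rewrite /conv/= !mxE. Qed.

Lemma conv_flow p y1 y2 t k i j : (conv2 p y1 y2).1.2 t k i j =
  p%:num * y1.1.2 t k i j + p%:num.~ * y2.1.2 t k i j.
Proof. by rewrite /conv/= !mxE. Qed.

Lemma conv_exit p y1 y2 t k i : (conv2 p y1 y2).2 t k i =
  p%:num * y1.2 t k i + p%:num.~ * y2.2 t k i.
Proof. by rewrite /conv/= !mxE. Qed.

Lemma conv_sum p (I : finType) (A : pred I) (g1 g2 : I -> R) :
  \sum_(i | A i) (p%:num * g1 i + p%:num.~ * g2 i) =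
  p%:num * \sum_(i | A i) g1 i + p%:num.~ * \sum_(i | A i) g2 i.
Proof. by rewrite big_split/= -!mulr_sumr. Qed.

Lemma conv_flow_out p y1 y2 t k i :
  \sum_(j in util k) (conv2 p y1 y2).1.2 t k i j =
  p%:num * \sum_(j in util k) y1.1.2 t k i j +
  p%:num.~ * \sum_(j in util k) y2.1.2 t k i j.
Proof. by rewrite -conv_sum; apply: eq_bigr => j _; exact: conv_flow. Qed.

Lemma conv_flow_in p y1 y2 t k i :
  \sum_(j in util k) (conv2 p y1 y2).1.2 t k j i =
  p%:num * \sum_(j in util k) y1.1.2 t k j i +
  p%:num.~ * \sum_(j in util k) y2.1.2 t k j i.
Proof. by rewrite -conv_sum; apply: eq_bigr => j _; exact: conv_flow. Qed.

Lemma conv_nneg p (a b : R) : 0 <= a -> 0 <= b -> 0 <= p%:num * a + p%:num.~ * b.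
Proof. by move=> a0 b0; rewrite addr_ge0// mulr_ge0// onem_ge0. Qed.

Lemma conv_mono p (a b a' b' : R) : a <= a' -> b <= b' ->
  p%:num * a + p%:num.~ * b <= p%:num * a' + p%:num.~ * b'.
Proof. by move=> aa' bb'; rewrite lerD// ler_wpM2l// onem_ge0. Qed.

Lemma conv_cst p (a : R) : p%:num * a + p%:num.~ * a = a.
Proof. by rewrite -mulrDl add_onemK mul1r. Qed.

Lemma weighted_volume_ge0 (x : state) j : state_space x ->
  0 <= \sum_k weight P k j * x k j.
Proof.
have [_ _ w0 _ _] := hP => -[x0 _].
by apply: sumr_ge0 => k _; rewrite mulr_ge0// ltW.
Qed.

Lemma cell_supply_ge0 (x : state) j : state_space x -> 0 <= cell_supply P x j.
Proof.
by have [_ [s0 _] _ _ _] := hP => xX; exact/s0/weighted_volume_ge0.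
Qed.

(** Adjacent cells meet at a node of the network, whereas on-ramps start in the
    external world. *)
Lemma onramp_inflow0 (f : comm -> 'M[R]_(ncell N)) i : i \in onramps N ->
  (forall k i j, ~~ adj k i j -> f k i j = 0) ->
  \sum_k \sum_(j in util k) f k j i = 0.
Proof.
rewrite inE => /eqP io f0; rewrite big1// => k _; rewrite big1// => j _.
by rewrite f0// /adj io eqxx !andbF.
Qed.

Lemma measurable_conv p (D : set R) g g1 g2 :
  (forall t, g t = p%:num * g1 t + p%:num.~ * g2 t) ->
  measurable_fun D g1 -> measurable_fun D g2 -> measurable_fun D g.
Proof.
move=> /funext -> m1 m2; apply: measurable_funD;
  by apply: measurable_funM => //; exact: measurable_cst.
Qed.

(** Every constraint is affine, or bounds a linear function of the flows by a
    concave function of the volumes, except for the supplies of on-ramps; these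
    are nonnegative and on-ramps receive no flow. *)
Lemma convex_feasible2 : convex_set (feasible2 P : set (convex_lmodType relaxed)).
Proof.
have [hd [hs0 hs] w0 _ _] := hP.
move=> y1 y2 p /set_mem[[mf1 mm1] i1 b1 c1 o1] /set_mem[[mf2 mm2] i2 b2 c2 o2].
apply/mem_set; split.
- split=> k i => [j|].
    exact: measurable_conv (fun t => conv_flow p y1 y2 t k i j)
      (mf1 k i j) (mf2 k i j).
  exact: measurable_conv (fun t => conv_exit p y1 y2 t k i) (mm1 k i) (mm2 k i).
- by apply/matrixP => k i; rewrite conv_volume i1 i2 conv_cst.
- move=> t tT; have [[x1 n1] f1 a1 m1 s1] := b1 t tT.
  have [[x2 n2] f2 a2 m2 s2] := b2 t tT; split.
  + split=> [k i|k i ik]; rewrite conv_volume; first exact: conv_nneg.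
    by rewrite n1// n2// conv_cst.
  + by move=> k i j; rewrite conv_flow conv_nneg.
  + by move=> k i j ij; rewrite conv_flow a1// a2// conv_cst.
  + by move=> k i; rewrite conv_exit conv_nneg.
  + by move=> k i ik; rewrite conv_exit s1// s2// conv_cst.
- move=> t tT; have [[x1 n1] f1 a1 m1 s1] := b1 t tT.
  have [[x2 n2] f2 a2 m2 s2] := b2 t tT.
  have [d1 u1] := c1 t tT; have [d2 u2] := c2 t tT; split.
    move=> k i ik; have [_ _ dcve _ _] := hd k i ik.
    rewrite conv_volume; apply: le_trans (concave_nnegP p dcve (x1 k i) (x2 k i)).
    rewrite conv_exit conv_flow_out addrACA -!mulrDr.
    by apply: conv_mono; [exact: d1|exact: d2].
  move=> i; have [io|io] := boolP (i \in onramps N).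
    rewrite onramp_inflow0//; last first.
      by move=> k i' j ij; rewrite conv_flow a1// a2// conv_cst.
    apply: cell_supply_ge0; split=> [k i'|k i' ik]; rewrite conv_volume.
      exact: conv_nneg.
    by rewrite n1// n2// conv_cst.
  have [_ scve _] := hs i io; rewrite /cell_supply.
  under [X in _ <= supply P i X]eq_bigr do rewrite conv_volume mulrDr
    [X in X + _]mulrCA [X in _ + X]mulrCA.
  rewrite conv_sum.
  apply: le_trans (concave_nnegP p scve _ _); [|exact: weighted_volume_ge0..].
  under eq_bigr do rewrite conv_flow_in.
  rewrite conv_sum; apply: conv_mono; [exact: u1|exact: u2].
- move=> k i ik.
  have := ode_solution_lin p%:num p%:num.~ (o1 k i ik) (o2 k i ik).
  under [X in ode_solution _ X _ -> _]eq_fun do rewrite -conv_volume.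
  apply: ode_solution_eq => t _; rewrite conv_exit conv_flow_in conv_flow_out.
  rewrite -[X in _ = X + _ - _ - _](conv_cst p); ring.
Qed.

End relaxed_problem.

(** * Convexity of the relaxed objective *)

Section relaxed_cost.
Variables (R : realType) (N : network) (P : traffic R N).
Local Notation state := 'M[R]_(ncomm N, ncell N).
Variable phi : state * state -> R.
Hypotheses (hP : traffic_axioms P) (hphi : cost_axioms phi).
Local Notation T := (horizon P).
Local Notation relaxed := (relaxed R N).
Local Notation conv2 := (@conv R (convex_lmodType relaxed)).
Local Notation mu := (@lebesgue_measure R).
Implicit Types (y : relaxed) (p : {i01 R}).

Lemma feasible2_ge0 y t k i : feasible2 P y -> 0 <= t <= T ->
  0 <= y.1.1 t k i /\ 0 <= relaxed_outflow (y.1.2 t) (y.2 t) k i.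
Proof.
move=> [_ _ b _ _] tT; have [[x0 _] f0 _ m0 _] := b t tT; split => //.
by rewrite mxE; case: ifP => // _; rewrite addr_ge0// sumr_ge0.
Qed.

(** The volumes are continuous on a compact interval; the demand constraint and
    the monotonicity of demand then bound the outflows. *)
Lemma feasible2_bounded y : feasible2 P y ->
  exists M, forall t, 0 <= t <= T -> forall k i,
    0 <= y.1.1 t k i <= M /\ 0 <= relaxed_outflow (y.1.2 t) (y.2 t) k i <= M.
Proof.
move=> yF; have [_ _ b c o] := yF.
have [hd _ _ _ [T0 _]] := hP.
have H (ki : 'I_(ncomm N) * 'I_(ncell N)) : exists M, forall t, 0 <= t <= T ->
    y.1.1 t ki.1 ki.2 <= M /\
    relaxed_outflow (y.1.2 t) (y.2 t) ki.1 ki.2 <= M.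
  case: ki => k i /=; have [ik|ik] := boolP (i \in util k); last first.
    exists 0 => t tT; have [[_ x0] _ _ _ _] := b t tT.
    by rewrite mxE (negbTE ik) x0.
  have [M M0 xM] := absolutely_continuous_bounded T0 (o k i ik).1.
  have [_ _ _ dmono _] := hd k i ik.
  exists (Num.max M (demand P k i M)) => t tT; rewrite !le_max xM//=; split => //.
  rewrite mxE ik; apply/orP; right; have [d1 _] := c t tT.
  apply: le_trans (d1 k i ik) _; apply: dmono; rewrite ?in_itv/= ?andbT//.
    by have [] := feasible2_ge0 k i yF tT.
  exact: xM.
have [M HM] := choice H.
exists (\big[Num.max/0]_ki M ki) => t tT k i.
have [-> ->] := feasible2_ge0 k i yF tT.
have [xM zM] := HM (k, i) t tT.
by split; [apply: le_trans xM _|apply: le_trans zM _]; exact: le_bigmax.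
Qed.

Lemma feasible2_integrable y : feasible2 P y ->
  mu.-integrable `[0, T] (EFin \o running_cost2 phi y).
Proof.
move=> yF; have [[mf mm] _ b _ o] := yF; have [M yM] := feasible2_bounded yF.
apply: (integrable_cost hphi _ _ yM) => k i.
  have [ik|ik] := boolP (i \in util k).
    exact: absolutely_continuous_measurable (o k i ik).1.
  apply: (@eq_measurable_fun _ _ R R _ (cst (0 : R))); last exact: measurable_cst.
  move=> t; rewrite inE/= in_itv/= => tT; have [[_ x0] _ _ _ _] := b t tT.
  by rewrite x0.
rewrite (_ : (fun t => _) = fun t => if i \in util k
    then y.2 t k i + \sum_(j in util k) y.1.2 t k i j else 0); last first.
  by apply/funext => t; rewrite mxE.
case: (boolP (i \in util k)) => _; last exact: measurable_cst.
by apply: measurable_funD => //; apply: measurable_sum_cond => j _.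
Qed.

Lemma conv_outflow p y1 y2 t :
  relaxed_outflow ((conv2 p y1 y2).1.2 t) ((conv2 p y1 y2).2 t) =
  p%:num *: relaxed_outflow (y1.1.2 t) (y1.2 t) +
  p%:num.~ *: relaxed_outflow (y2.1.2 t) (y2.2 t).
Proof.
apply/matrixP => k i.
rewrite [LHS]mxE conv_exit conv_flow_out !mxE; case: ifP => _.
  by rewrite !mulrDr addrACA.
by rewrite !mulr0 addr0.
Qed.

Lemma convex_cost2 :
  convex_function (feasible2 P : set (convex_lmodType relaxed)) (cost2 P phi).
Proof.
have [phicvx _ _] := hphi.
move=> p y1 y2 y1F y2F.
have iconv := feasible2_integrable (set_mem (convex_feasible2 hP p y1F y2F)).
move/set_mem : y1F => y1F; move/set_mem : y2F => y2F.
have i1 := feasible2_integrable y1F; have i2 := feasible2_integrable y2F.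
have iZ (a : R) g : mu.-integrable `[0, T] (EFin \o g) ->
    mu.-integrable `[0, T] (EFin \o (fun t => a * g t)).
  by move=> ig; exact: (integrableZl _ a ig).
rewrite convRE /cost2 -!RintegralZl// -RintegralD//; [|exact: iZ..].
apply: le_Rintegral => //.
  exact: (integrableD _ (iZ p%:num _ i1) (iZ p%:num.~ _ i2)).
move=> t; rewrite /= in_itv/= => tT.
pose q y : state * state := (y.1.1 t, relaxed_outflow (y.1.2 t) (y.2 t)).
have Dq y : feasible2 P y -> cost_domain (q y).
  by move=> yF; split=> k i; have [] := feasible2_ge0 k i yF tT.
have := phicvx p (q y1) (q y2) (mem_set (Dq _ y1F)) (mem_set (Dq _ y2F)).
rewrite convRE; apply: le_trans.
by rewrite /running_cost2 conv_outflow.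
Qed.

Lemma relaxed_problem_convex : convex_problem2 P phi.
Proof.
split; [exact: convex_feasible2|exact: feasible2_integrable|exact: convex_cost2].
Qed.

End relaxed_cost.

(** * The FIFO coefficient and the flows it generates *)

Section supply_ratio.
Variable R : realType.
Implicit Types t D S : R.

(** The largest factor between 0 and 1 that brings the load [D] to at
    most the supply [S]. *)
Definition supply_ratio D S : R := if D <= S then 1 else S / D.

Lemma supply_ratio_ge0 D S : 0 <= S -> 0 <= supply_ratio D S.
Proof.
move=> S0; rewrite /supply_ratio; case: (leP D S) => // SD.
by rewrite divr_ge0// ltW// (le_lt_trans S0).
Qed.

Lemma scaled_le_supply t D S : 0 <= t <= 1 -> 0 <= S ->
  (t * D <= S) = (t <= supply_ratio D S).
Proof.
move=> /andP[t0 t1] S0; rewrite /supply_ratio; case: (leP D S) => [DS|SD].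
  rewrite t1; have [D0|D0] := leP 0 D.
    by rewrite (le_trans _ DS)// ler_piMl.
  by rewrite (le_trans _ S0)// mulr_ge0_le0// ltW.
by rewrite ler_pdivlMr// (le_lt_trans S0).
Qed.

Lemma supply_ratio_le1 D S : 0 <= S -> supply_ratio D S <= 1.
Proof.
move=> S0; rewrite /supply_ratio; case: (leP D S) => // SD.
by rewrite ler_pdivrMr ?mul1r ?(le_lt_trans S0)// ltW.
Qed.

Lemma measurable_supply_ratio (A : set R) (D S : R -> R) : measurable A ->
  (forall t, A t -> 0 <= D t) ->
  measurable_fun A D -> measurable_fun A S ->
  measurable_fun A (fun t => supply_ratio (D t) (S t)).
Proof.
move=> mA D0 mD mS.
(* The inverse is written as a real power, which is measurable on the line. *)
apply: (@eq_measurable_fun _ _ _ _ A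
    (fun t => if D t <= S t then 1 else S t * D t `^ (-1))).
  by move=> t; rewrite inE => /D0 Dt; rewrite powR_inv1.
apply: measurable_fun_if => //; first exact: measurable_fun_ler.
apply: (measurable_funS mA); first exact: subIsetl.
apply: measurable_funM => //.
exact: (measurableT_comp (measurable_powR (-1)) mD).
Qed.

Lemma measurable_bigmin (A : set R) (I : Type) (s : seq I) (c : R)
    (g : I -> R -> R) :
  (forall i, measurable_fun A (g i)) ->
  measurable_fun A (fun t => \big[Num.min/c]_(i <- s) g i t).
Proof.
move=> mg; elim: s => [|i s IHs].
  by under eq_fun do rewrite big_nil; exact: measurable_cst.
by under eq_fun do rewrite big_cons; exact: measurable_minr.
Qed.

End supply_ratio.

Section fifo.
Variables (R : realType) (N : network) (P : traffic R N).
Hypothesis hP : traffic_axioms P.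
Local Notation cell := 'I_(ncell N).
Local Notation comm := 'I_(ncomm N).
Local Notation state := 'M[R]_(ncomm N, ncell N).
Local Notation routing := (comm -> 'M[R]_(ncell N)).
Local Notation T := (horizon P).
Implicit Types (x a : state) (r : routing).

Definition cell_load x a r (j : cell) : R :=
  \sum_k \sum_(h in util k) r k h j * a k h * demand P k h (x k h).

(** The minimum runs over all pairs of a commodity and a cell, the pairs that
    impose no constraint contributing 1, so that measurability in time can be
    checked term by term. *)
Definition fifo_bound x a r (i : cell) : R :=
  \big[Num.min/1]_(kj : comm * cell)
    (if 0 < r kj.1 i kj.2
     then supply_ratio (cell_load x a r kj.2) (cell_supply P x kj.2) else 1).

Lemma fifo_bound_ge0 x a r i : state_space x -> 0 <= fifo_bound x a r i.
Proof.
move=> xX; apply/bigmin_geP; split=> // kj _; case: ifP => // _.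
exact/supply_ratio_ge0/(cell_supply_ge0 hP).
Qed.

Lemma fifo_bound_le1 x a r i : fifo_bound x a r i <= 1.
Proof. exact: bigmin_le_id. Qed.

Lemma fifo_feasibleE x a r i : state_space x ->
  fifo_feasible P x a r i = `[0, fifo_bound x a r i]%classic.
Proof.
move=> xX; apply/seteqP; split=> t /=; rewrite in_itv/=.
  move=> [t01 tS]; have /andP[-> t1] := t01.
  apply/bigmin_geP; split=> // -[k j] _ /=.
  case: ifPn => // rk; rewrite -scaled_le_supply//; first by apply: tS; exists k.
  exact: cell_supply_ge0.
move=> /andP[t0 /bigmin_geP[t1 tS]]; split=> [|j [k rk]]; first by rewrite t0.
rewrite scaled_le_supply ?t0//; last exact: cell_supply_ge0.
by have := tS (k, j) isT; rewrite /= rk.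
Qed.

(** The constraints on a scaling factor are upper bounds, so the admissible
    factors form the interval from 0 to the smallest of these bounds. *)
Lemma fifo_gammaE x a r i : state_space x ->
  fifo_gamma P x a r i = fifo_bound x a r i.
Proof.
move=> xX; have g0 := fifo_bound_ge0 a r i xX.
rewrite /fifo_gamma fifo_feasibleE//; apply: xget_unique => /=.
  split; first by rewrite /= in_itv/= g0 lexx.
  by move=> t /=; rewrite in_itv/= => /andP[].
move=> t [/=]; rewrite in_itv/= => /andP[t0 tg] tub.
by apply/eqP; rewrite eq_le tg tub//= in_itv/= g0 lexx.
Qed.

Section admissible.
Variables (x a : state) (r : routing).
Hypotheses (xX : state_space x) (aO : control_set a)
  (rR : forall k, routing_matrices k (r k)).

Lemma fifo_gamma_bounds i : 0 <= fifo_gamma P x a r i <= 1.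
Proof. by rewrite fifo_gammaE// fifo_bound_ge0//= fifo_bound_le1. Qed.

Lemma fifo_gamma_le_ratio k i j : 0 < r k i j ->
  fifo_gamma P x a r i <= supply_ratio (cell_load x a r j) (cell_supply P x j).
Proof.
move=> rk; rewrite fifo_gammaE//.
by apply: (bigmin_inf (k, j)) => //=; rewrite rk.
Qed.

Lemma routing_ge0 k i j : 0 <= r k i j.
Proof. by have [] := rR k. Qed.

Lemma routing_eq0 k i j : ~~ adj k i j -> r k i j = 0.
Proof. by have [_ _ _] := rR k; exact. Qed.

Lemma demand_ge0 k i : i \in util k -> 0 <= demand P k i (x k i).
Proof.
by have [hd _ _ _ _] := hP => ik; have [+ _ _ _ _] := hd k i ik; apply; case: xX.
Qed.

Lemma routed_demand_ge0 k i j : 0 <= r k i j * a k i * demand P k i (x k i).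
Proof.
have [ij|ij] := boolP (adj k i j); last by rewrite routing_eq0// !mul0r.
have /and4P[ik _ _ _] := ij; have /andP[a0 _] := aO k i.
by rewrite !mulr_ge0// ?routing_ge0// demand_ge0.
Qed.

Lemma flowE k i j : flow P x a r k i j =
  fifo_gamma P x a r i * (r k i j * a k i * demand P k i (x k i)).
Proof. by rewrite mxE !mulrA. Qed.

Lemma flow_ge0 k i j : 0 <= flow P x a r k i j.
Proof.
have /andP[g0 _] := fifo_gamma_bounds i.
by rewrite flowE mulr_ge0// routed_demand_ge0.
Qed.

Lemma flow_eq0 k i j : ~~ adj k i j -> flow P x a r k i j = 0.
Proof. by move=> ij; rewrite flowE routing_eq0// !mul0r mulr0. Qed.

Lemma offramp_flow_eq0 k i j : i \in offramps N -> flow P x a r k i j = 0.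
Proof.
rewrite inE => /eqP hi; apply: flow_eq0; rewrite /adj hi.
by apply/negP => /and4P[_ _ /eqP <-].
Qed.

(** The upstream cells may have different FIFO coefficients, but each that sends
    flow to [i] has one at most the supply ratio [c] of [i]; replacing them all
    by [c] leaves [c] times the load of [i], which is at most the supply. *)
Lemma inflow_le_supply i :
  \sum_k \sum_(j in util k) flow P x a r k j i <= cell_supply P x i.
Proof.
have S0 := cell_supply_ge0 hP i xX.
set c := supply_ratio (cell_load x a r i) (cell_supply P x i).
apply: (@le_trans _ _ (c * cell_load x a r i)); last first.
  by rewrite scaled_le_supply// supply_ratio_ge0//= supply_ratio_le1.
rewrite mulr_sumr ler_sum// => k _; rewrite mulr_sumr ler_sum// => j _.
have := routing_ge0 k j i; rewrite le_eqVlt => /predU1P[r0|r0].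
  by rewrite flowE -r0 !mul0r !mulr0.
by rewrite flowE ler_wpM2r ?routed_demand_ge0// (fifo_gamma_le_ratio r0).
Qed.

Lemma outgoing_flow_le_demand k i : i \in util k ->
  \sum_(j in util k) flow P x a r k i j <= a k i * demand P k i (x k i).
Proof.
move=> ik; have d0 := demand_ge0 ik; have /andP[a0 _] := aO k i.
have [io|io] := boolP (i \in offramps N).
  by rewrite big1 ?mulr_ge0// => j _; exact: offramp_flow_eq0.
have [_ r1 _ _] := rR k; have /andP[g0 g1] := fifo_gamma_bounds i.
apply: (@le_trans _ _ (\sum_j r k i j * (a k i * demand P k i (x k i)))).
  rewrite [leRHS](bigID (mem (util k)))/= -[leLHS]addr0 lerD//.
    apply: ler_sum => j _; rewrite flowE [leRHS]mulrA ler_piMl//.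
    exact: routed_demand_ge0.
  by apply: sumr_ge0 => j _; rewrite !mulr_ge0 ?routing_ge0.
by rewrite -mulr_suml r1 ?mul1r// inE io.
Qed.

(** Off-ramps send no flow to other cells and other cells have no exit flow, so
    the relaxed outflow [mu + sum of flows] is the outflow of the original
    dynamics in both cases. *)
Lemma outflowE k i : i \in util k -> outflow P x a r k i =
  (if i \in offramps N :&: util k then outflow P x a r k i else 0) +
  \sum_(j in util k) flow P x a r k i j.
Proof.
move=> ik; rewrite inE ik andbT; case: ifPn => io.
  by rewrite big1 ?addr0// => j _; exact: offramp_flow_eq0.
by rewrite mxE ik (negbTE io) add0r.
Qed.

Lemma outflow_bounds k i : i \in util k ->
  0 <= outflow P x a r k i <= demand P k i (x k i).
Proof.
move=> ik; have d0 := demand_ge0 ik; have /andP[a0 a1] := aO k i.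
have ad : a k i * demand P k i (x k i) <= demand P k i (x k i).
  by rewrite ler_piMl.
rewrite mxE ik; case: ifP => _; first by rewrite mulr_ge0.
rewrite sumr_ge0 => [|j _]; last exact: flow_ge0.
exact: le_trans (outgoing_flow_le_demand ik) ad.
Qed.

End admissible.
End fifo.

(** * Trajectories of the original problem are feasible for the relaxed one *)

Section relaxation.
Variables (R : realType) (N : network) (P : traffic R N).
Hypothesis hP : traffic_axioms P.
Local Notation cell := 'I_(ncell N).
Local Notation comm := 'I_(ncomm N).
Local Notation state := 'M[R]_(ncomm N, ncell N).
Local Notation routing := (comm -> 'M[R]_(ncell N)).
Local Notation T := (horizon P).
Variables (a : R -> state) (r : R -> routing) (x : R -> state).
Hypothesis axF : feasible1 P a r x.

Let mI : measurable (`[0, T]%classic : set R). Proof. by []. Qed.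

Lemma feasible1_states t : `[0, T]%classic t ->
  [/\ state_space (x t), control_set (a t) &
      forall k, routing_matrices k (r t k)].
Proof.
have [_ _ ar [_ xX] _] := axF; rewrite /= in_itv/= => tT.
by have [] := ar t tT; split => //; exact: xX.
Qed.

Lemma measurable_routing k i j : measurable_fun `[0, T] (fun t => r t k i j).
Proof.
have [_ + _ _ _] := axF; move=> /(_ k i j).
exact: piecewise_continuous_measurable.
Qed.

Lemma measurable_control k i : measurable_fun `[0, T] (fun t => a t k i).
Proof.
have [+ _ _ _ _] := axF; move=> /(_ k i).
exact: piecewise_continuous_measurable.
Qed.

Lemma measurable_volume k i : measurable_fun `[0, T] (fun t => x t k i).
Proof.
have [_ _ _ _ o] := axF; have [ik|ik] := boolP (i \in util k).
  exact: absolutely_continuous_measurable (o k i ik).1.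
apply: (@eq_measurable_fun _ _ R R _ (cst (0 : R))); last exact: measurable_cst.
by move=> t; rewrite inE => /feasible1_states[[_ x0] _ _]; rewrite x0.
Qed.

Lemma measurable_demand k i : i \in util k ->
  measurable_fun `[0, T] (fun t => demand P k i (x t k i)).
Proof.
move=> ik; have [hd _ _ _ _] := hP; have [_ _ _ dmono _] := hd k i ik.
apply: (measurable_comp_nondecreasing_nneg dmono) => //.
  by move=> t /feasible1_states[[]].
exact: measurable_volume.
Qed.

Lemma measurable_cell_supply j : j \notin onramps N ->
  measurable_fun `[0, T] (fun t => cell_supply P (x t) j).
Proof.
move=> jo; have [_ [_ hs] _ _ _] := hP; have [_ _ smono] := hs j jo.
rewrite -[X in measurable_fun _ X]opprK; apply: measurable_funN.
apply: (@measurable_comp_nondecreasing_nneg _ _ (fun b => - supply P j b)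
  (fun t => \sum_k weight P k j * x t k j)) => //.
- by move=> b c b0 c0 bc; rewrite lerN2; exact: smono.
- by move=> t /feasible1_states[xX _ _]; exact: (weighted_volume_ge0 hP).
- apply: measurable_sum => k; apply: measurable_funM; first exact: measurable_cst.
  exact: measurable_volume.
Qed.

Lemma measurable_cell_load j :
  measurable_fun `[0, T] (fun t => cell_load P (x t) (a t) (r t) j).
Proof.
apply: measurable_sum => k; apply: measurable_sum_cond => i ik.
apply: measurable_funM; last exact: measurable_demand.
by apply: measurable_funM; [exact: measurable_routing|exact: measurable_control].
Qed.

(** Supply functions of on-ramps may fail to be measurable, but nothing is routed
    to an on-ramp, so their ratios do not enter the minimum. *)
Lemma measurable_fifo_gamma i :
  measurable_fun `[0, T] (fun t => fifo_gamma P (x t) (a t) (r t) i).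
Proof.
apply: (@eq_measurable_fun _ _ R R _
    (fun t => fifo_bound P (x t) (a t) (r t) i)).
  by move=> t; rewrite inE => /feasible1_states[xX _ _]; rewrite (fifo_gammaE hP).
apply: measurable_bigmin => -[k j] /=.
have [jo|jo] := boolP (j \in onramps N).
  apply: (@eq_measurable_fun _ _ R R _ (cst (1 : R))); last exact: measurable_cst.
  move=> t; rewrite inE => /feasible1_states[_ _ rR].
  rewrite (routing_eq0 rR) ?ltxx//.
  by move: jo; rewrite inE /adj => ->; rewrite !andbF.
apply: measurable_fun_if => //.
- apply: measurable_fun_ltr; first exact: measurable_cst.
  exact: measurable_routing.
- apply: (measurable_funS mI); first exact: subIsetl.
  apply: measurable_supply_ratio => //.
  + move=> t /feasible1_states[xX aO rR].
    apply: sumr_ge0 => k' _; apply: sumr_ge0 => h _.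
    exact: (routed_demand_ge0 hP xX aO rR).
  + exact: measurable_cell_load.
  + exact: measurable_cell_supply.
Qed.

Lemma measurable_flow k i j :
  measurable_fun `[0, T] (fun t => flow P (x t) (a t) (r t) k i j).
Proof.
have [ij|ij] := boolP (adj k i j); last first.
  apply: (@eq_measurable_fun _ _ R R _ (cst (0 : R))); last exact: measurable_cst.
  by move=> t; rewrite inE => /feasible1_states[_ _ rR]; rewrite flow_eq0.
have /and4P[ik _ _ _] := ij.
rewrite (_ : (fun t => _) = fun t => fifo_gamma P (x t) (a t) (r t) i *
   r t k i j * a t k i * demand P k i (x t k i)); last first.
  by apply/funext => t; rewrite mxE.
apply: measurable_funM; last exact: measurable_demand.
apply: measurable_funM; last exact: measurable_control.
by apply: measurable_funM; [exact: measurable_fifo_gamma|exact: measurable_routing].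
Qed.

Lemma relaxation_feasible : feasible2 P (relaxation P a r x).
Proof.
have [_ _ _ [x0 _] o] := axF.
split => //=.
- split=> k i; first by move=> j; exact: measurable_flow.
  rewrite (_ : (fun t => _) = fun t => if i \in (offramps N :&: util k)%SET
     then a t k i * demand P k i (x t k i) else 0); last first.
    apply/funext => t; rewrite mxE; case: ifPn => //.
    by rewrite inE => /andP[io ik]; rewrite mxE ik io.
  case: (boolP (i \in _)) => [|_]; last exact: measurable_cst.
  rewrite inE => /andP[_ ik].
  by apply: measurable_funM; [exact: measurable_control|exact: measurable_demand].
- move=> t tT; have /feasible1_states[xX aO rR] : `[0, T]%classic t.
    by rewrite /= in_itv.
  split=> //.
  + by move=> k i j; exact: flow_ge0.
  + by move=> k i j; exact: flow_eq0.
  + move=> k i; rewrite mxE; case: ifPn => //; rewrite inE => /andP[_ ik].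
    by have /andP[] := outflow_bounds hP xX aO rR ik.
  + by move=> k i ik; rewrite mxE (negbTE ik).
- move=> t tT; have /feasible1_states[xX aO rR] : `[0, T]%classic t.
    by rewrite /= in_itv.
  split=> [k i ik|i]; last exact: inflow_le_supply.
  rewrite mxE -(outflowE _ _ _ rR ik).
  by have /andP[] := outflow_bounds hP xX aO rR ik.
- move=> k i ik; apply: ode_solution_eq (o k i ik) => t /andP[t0 tT].
  have /feasible1_states[xX aO rR] : `[0, T]%classic t.
    by rewrite /= in_itv/= !ltW.
  by rewrite [X in _ - X = _](outflowE _ _ _ rR ik) [in RHS]mxE opprD addrA addrAC.
Qed.

End relaxation.

Theorem proposition2 (R : realType) (N : network) (P : traffic R N)
    (phi : 'M[R]_(ncomm N, ncell N) * 'M[R]_(ncomm N, ncell N) -> R)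
    (hN : network_axioms N) (hP : traffic_axioms P) (hphi : cost_axioms phi) :
  convex_problem2 P phi /\
  (forall (a : R -> 'M[R]_(ncomm N, ncell N))
          (r : R -> 'I_(ncomm N) -> 'M[R]_(ncell N))
          (x : R -> 'M[R]_(ncomm N, ncell N)),
     feasible1 P a r x -> feasible2 P (relaxation P a r x)).
Proof.
split; first exact: relaxed_problem_convex.
by move=> a r x; exact: relaxation_feasible.
Qed.
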